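(* Let $T$ and $U$ be regular trees, both of degree at least $3$. Let $A=\mathrm{Aut}(T)\times \mathrm{Aut}(U)$. Then for every $n\geq 2$ there is a subset $X\subseteq A^{n}$ of infinite (product Haar) measure such that for all $\mathbf{a}=(a_1,\dots,a_n)\in X$, the closure in $A$ of the subgroup generated by $a_1,\dots,a_n$ is neither discrete, nor open, nor compact.
   Context: The automorphism group of a regular tree carries the topology of pointwise convergence on vertices, making it a locally compact, totally disconnected, unimodular group; its Haar measure is normalized so that vertex stabilizers have measure $1$. $A$ carries the product topology and the product of the two normalized Haar measures, and $A^n$ carries the corresponding $n$-fold product measure. *)

(* Defs.v *)
From HB Require Import structures.
From mathcomp Require Import all_boot all_order all_algebra.
From mathcomp Require Import all_classical all_reals all_analysis.

Set Implicit Arguments.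
Unset Strict Implicit.
Unset Printing Implicit Defensive.

Import Order.TTheory GRing.Theory Num.Theory.

Local Open Scope classical_set_scope.
Local Open Scope ring_scope.

(* The degree is finite, so that the automorphism group is locally compact;
   acyclicity excludes closed simple paths of length at least 3. *)
Record regularTree := RegularTree {
  vertex :> choiceType;
  adj : rel vertex;
  degree : nat;
  adj_sym : symmetric adj;
  adj_irrefl : irreflexive adj;
  tree_nonempty : inhabited vertex;
  tree_connected : forall x y, exists2 p, path adj x p & last x p = y;
  tree_acyclic : forall c : seq vertex, (2 < size c)%N -> ~ ucycle adj c;
  tree_regular : forall x, ([set y | adj x y] #= `I_degree)%card
}.
Arguments adj {r}.

Section aut_group.
Variable T : regularTree.

Definition is_aut : pred (T -> T) :=
  fun f => `[< bijective f /\ {mono f : x y / adj x y} >].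

Record aut := Aut { aut_fun :> T -> T; aut_funP : is_aut aut_fun }.

HB.instance Definition _ := [isSub for aut_fun].
HB.instance Definition _ := [Choice of aut by <:].

Lemma autP (g h : aut) : g =1 h -> g = h.
Proof. by move=> gh; apply/val_inj/funext. Qed.

Lemma aut_bij (g : aut) : bijective g.
Proof. by have /asboolP[] := aut_funP g. Qed.

Lemma aut_adj (g : aut) : {mono g : x y / adj x y}.
Proof. by have /asboolP[] := aut_funP g. Qed.

Fact aut_one_subproof : is_aut id.
Proof. by apply/asboolP; split => //; exists id. Qed.
Definition aut_one := Aut aut_one_subproof.

Fact aut_mul_subproof (g h : aut) : is_aut (g \o h).
Proof.
apply/asboolP; split; first exact: bij_comp (aut_bij g) (aut_bij h).
by move=> x y /=; rewrite !aut_adj.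
Qed.
Definition aut_mul g h := Aut (aut_mul_subproof g h).

Fact aut_inv_ex (g : aut) : exists h : aut, cancel g h /\ cancel h g.
Proof.
have [f gf fg] := aut_bij g.
have fP : is_aut f.
  by apply/asboolP; split; [exists g | move=> x y; rewrite -(aut_adj g) !fg].
by exists (Aut fP).
Qed.
Definition aut_inv g := sval (cid (aut_inv_ex g)).

Fact aut_mulA : associative aut_mul.
Proof. by move=> f g h; apply: autP. Qed.
Fact aut_mul1 : left_id aut_one aut_mul.
Proof. by move=> g; apply: autP. Qed.
Fact aut_mulr1 : right_id aut_one aut_mul.
Proof. by move=> g; apply: autP. Qed.
Fact aut_mulV : left_inverse aut_one aut_inv aut_mul.
Proof. by move=> g; apply: autP => x; rewrite /= (svalP (cid (aut_inv_ex g))).1. Qed.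
Fact aut_mulrV : right_inverse aut_one aut_inv aut_mul.
Proof. by move=> g; apply: autP => x; rewrite /= (svalP (cid (aut_inv_ex g))).2. Qed.

HB.instance Definition _ :=
  isGroup.Build aut aut_mulA aut_mul1 aut_mulr1 aut_mulV aut_mulrV.

(* Topology of pointwise convergence on vertices, for discrete T. *)
Definition aut_ptws (g : aut) :
  {ptws discrete_topology T -> discrete_topology T} := aut_fun g.

HB.instance Definition _ := Topological.copy aut (initial_topology aut_ptws).

HB.instance Definition _ := isPointed.Build aut aut_one.

(* Borel sigma-algebra *)
HB.instance Definition _ :=
  Measurable.copy aut (g_sigma_algebraType (@open aut)).

Definition stabilizer (v : T) : set aut := [set g | g v = v].

Lemma aut_open_eval (v w : T) : open [set g : aut | g v = w].
Proof.
exists [set f : {ptws discrete_topology T -> discrete_topology T} | f v = w] => //.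
apply: (@open_comp {ptws discrete_topology T -> discrete_topology T}
  (discrete_topology T) (fun f => f v) [set w]); last exact: discrete_open.
by move=> f _; exact: (@proj_continuous (discrete_topology T)
  (fun=> discrete_topology T) v).
Qed.

End aut_group.

Lemma product_sigma_finite d1 d2 (A : measurableType d1) (B : measurableType d2)
    (R : realType) (m1 : {sigma_finite_measure set A -> \bar R})
    (m2 : {sigma_finite_measure set B -> \bar R}) :
  sigma_finite setT (m1 \x m2)%E.
Proof.
have /sigma_finiteP[F [TF ndF Foo]] := sigma_finiteT m1.
have /sigma_finiteP[G [TG ndG Goo]] := sigma_finiteT m2.
exists (fun n => F n `*` G n).
  rewrite -setXTT TF TG predeqE => -[x y]; split.
    move=> [/= [n _ Fnx] [k _ Gky]]; exists (maxn n k) => //; split.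
    - by move: x Fnx; exact/subsetPset/ndF/leq_maxl.
    - by move: y Gky; exact/subsetPset/ndG/leq_maxr.
  by move=> [n _ []/= ? ?]; split; exists n.
move=> k; have [? ?] := Foo k; have [? ?] := Goo k.
split; first exact: measurableX.
by rewrite product_measure1E// lte_mul_pinfty// ge0_fin_numE.
Qed.

Section haar.
Local Open Scope ereal_scope.

(* Regularity and sigma-finiteness are automatic (the group is second countable
   and locally compact), the last clause fixes the scaling, and left invariance
   implies right invariance because the group is unimodular. *)
Record haarMeasure (R : realType) (T : regularTree) := HaarMeasure {
  haar_measure : {measure set (aut T) -> \bar R};
  haar_left_invariant : forall (g : aut T) (A : set (aut T)),
    measurable A -> haar_measure [set (g * x)%g | x in A] = haar_measure A;
  haar_compact : forall K : set (aut T), compact K -> haar_measure K < +oo;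
  haar_stabilizer : forall v : T, haar_measure (stabilizer v) = 1
}.

Lemma countable_tree (T : regularTree) : countable [set: T].
Proof.
have [x0] := tree_nonempty T.
pose B := fix B n := if n is m.+1 then \bigcup_(x in B m) [set y | adj x y]
  else [set x0].
suff -> : [set: T] = \bigcup_n B n.
  apply: bigcup_countable => // n _; apply: finite_set_countable.
  elim: n => [|n IHn] /=; first exact: finite_set1.
  apply: bigcup_finite => // x _.
  by exists (degree T); exact: tree_regular.
apply/seteqP; split=> // y _.
have [p px0 <-] := tree_connected x0 y.
suff: forall n x, B n x -> path adj x p -> B (n + size p)%N (last x p).
  by move=> /(_ 0%N x0 erefl px0) Bp; exists (size p).
elim: p {px0} => [|z p IHp] n x Bx /=; first by rewrite addn0.
by move=> /andP[xz zp]; rewrite -addSnnS; apply: IHp => //; exists x.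
Qed.

Definition haar R T (mu : haarMeasure R T) : set (aut T) -> \bar R :=
  haar_measure mu.

HB.instance Definition _ R T (mu : haarMeasure R T) :=
  Measure.on (haar mu).

Lemma haar_sigma_finite R T (mu : haarMeasure R T) :
  sigma_finite setT (haar mu).
Proof.
have [x0] := tree_nonempty T.
have Bmeas (w : T) : measurable [set g : aut T | g x0 = w].
  by apply: sub_sigma_algebra; exact: aut_open_eval.
have Bfin (w : T) : haar mu [set g : aut T | g x0 = w] < +oo.
  have [->|] := eqVneq [set g : aut T | g x0 = w] set0.
    by rewrite measure0.
  move=> /set0P[g /= gw].
  rewrite (_ : mkset _ = [set (g * x)%g | x in stabilizer x0]).
    rewrite /haar haar_left_invariant ?haar_stabilizer ?ltry//.
    exact: sub_sigma_algebra (aut_open_eval _ _).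
  apply/seteqP; split=> [h /= hw|_ [h /= hx0 <-]] /=; last by rewrite hx0.
  exists (g^-1 * h)%g; last by rewrite mulgA mulgV mul1g.
  by change (aut_inv g (h x0) = x0); rewrite hw -gw (svalP (cid (aut_inv_ex g))).1.
have [f finj] : exists f : T -> nat, injective f.
  have /countable_injP[f finj] := countable_tree T.
  by exists f => x y fxy; apply: finj; rewrite ?inE.
pose F n := if pselect (exists w, f w = n) is left e
  then [set g : aut T | g x0 = sval (cid e)] else set0.
exists F.
  apply/seteqP; split=> // g _; exists (f (g x0)) => //; rewrite /F.
  case: pselect => [e|[]]; last by exists (g x0).
  by apply/esym/finj; exact: svalP (cid e).
move=> n; rewrite /F; case: pselect => [e|_].
  by split; [exact: Bmeas|exact: Bfin].
by split; [exact: measurable0|rewrite measure0].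
Qed.

HB.instance Definition _ R T (mu : haarMeasure R T) :=
  Measure_isSigmaFinite.Build _ _ _ (haar mu) (haar_sigma_finite mu).

(* A separate name: for \x itself the library's inferred sigma-finite instance
   applies only to products of subprobability measures. *)
Definition product_haar R T U (mu : haarMeasure R T) (nu : haarMeasure R U) :
  set (aut T * aut U) -> \bar R := haar mu \x haar nu.

HB.instance Definition _ R T U (mu : haarMeasure R T) (nu : haarMeasure R U) :=
  Measure.on (product_haar mu nu).

HB.instance Definition _ R T U (mu : haarMeasure R T) (nu : haarMeasure R U) :=
  Measure_isSigmaFinite.Build _ _ _ (product_haar mu nu)
    (product_sigma_finite (haar mu) (haar nu)).

End haar.

Section sigma_finite_pack.
Context d (A : measurableType d) (R : realType) (N : {measure set A -> \bar R})
  (sf : sigma_finite setT N).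

Let M of sigma_finite setT N : set A -> \bar R := N.
HB.instance Definition _ := Measure.copy (M sf) N.
HB.instance Definition _ := Measure_isSigmaFinite.Build _ _ _ (M sf) sf.

Lemma sigma_finite_pack :
  exists m : {sigma_finite_measure set A -> \bar R}, N = m :> (set A -> \bar R).
Proof. by exists (M sf). Qed.

End sigma_finite_pack.

Section power_measure.
Local Open Scope ereal_scope.
Context d (A : measurableType d) (R : realType).

(* n-fold product measure, see [power_measureE]. The sigma-algebra on n-tuples
   is generated by the coordinate maps; over a second countable group this is
   the Borel sigma-algebra of the product topology. *)
Fixpoint power_measure (mu : set A -> \bar R) n : set (n.-tuple A) -> \bar R :=
  if n is m.+1
  then pushforward (mu \x @power_measure mu m)
         (fun p : A * m.-tuple A => [tuple of p.1 :: p.2])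
  else \d_[tuple].
Arguments power_measure mu n _ : clear implicits.

Context (mu : {sigma_finite_measure set A -> \bar R}).

Let mcons n : measurable_fun setT
  (fun p : A * n.-tuple A => [tuple of p.1 :: p.2]).
Proof. exact: measurable_cons. Qed.

Fact power_measure_subproof n :
  exists m : {sigma_finite_measure set (n.-tuple A) -> \bar R},
    power_measure mu n = m.
Proof.
elim: n => [|n [m IHm]] /=; first by exists \d_[tuple].
rewrite IHm.
have [F FT Ffin] := product_sigma_finite mu m.
have sf : sigma_finite setT (pushforward (mu \x m)
    (fun p : A * n.-tuple A => [tuple of p.1 :: p.2])).
  pose u (t : n.+1.-tuple A) := (thead t, [tuple of behead t]).
  have mu_ : measurable_fun setT u.
    apply: measurable_fun_pair => /=.
      exact: measurable_tnth.
    exact: measurable_behead.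
  exists (fun k => u @^-1` F k).
    by rewrite -preimage_bigcup -FT preimage_setT.
  move=> k; have [mF Fk] := Ffin k; split.
    by rewrite -[X in measurable X]setTI; exact: mu_.
  rewrite /pushforward (_ : _ @^-1` _ = F k)//.
  apply/seteqP; split=> -[x t] /=; rewrite /u theadE;
    by rewrite (_ : [tuple of _] = t) //; exact/val_inj.
pose M : {measure set _ -> \bar R} := pushforward (mu \x m)
  (fun p : A * n.-tuple A => [tuple of p.1 :: p.2]).
pose N := M (@mcons n).
exact: (sigma_finite_pack (N := N) sf).
Qed.

Let power_measure0 n : power_measure mu n set0 = 0.
Proof. by have [m ->] := power_measure_subproof n; rewrite measure0. Qed.

Let power_measure_ge0 n X : 0 <= power_measure mu n X.
Proof. by have [m ->] := power_measure_subproof n. Qed.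

Let power_measure_additive n : semi_sigma_additive (power_measure mu n).
Proof.
by have [m ->] := power_measure_subproof n; exact: measure_semi_sigma_additive.
Qed.

HB.instance Definition _ n := isMeasure.Build _ _ _ (power_measure mu n)
  (power_measure0 n) (@power_measure_ge0 n) (@power_measure_additive n).

Let power_measure_sigma_finite n : sigma_finite setT (power_measure mu n).
Proof.
by have [m ->] := power_measure_subproof n; exact: sigma_finiteT.
Qed.

HB.instance Definition _ n := Measure_isSigmaFinite.Build _ _ _
  (power_measure mu n) (power_measure_sigma_finite n).

Lemma power_measureE n (B : 'I_n -> set A) : (forall i, measurable (B i)) ->
  power_measure mu n [set t | forall i, B i (tnth t i)] = \prod_(i < n) mu (B i).
Proof.
elim: n B => [|n IHn] B mB /=.
  by rewrite big_ord0 diracE mem_set// => -[].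
rewrite big_ord_recl -IHn; last by move=> i; exact: mB.
rewrite -product_measure1E//; last first.
  rewrite (_ : mkset _ = \bigcap_(i in [set: 'I_n])
    ((fun t : n.-tuple A => tnth t i) @^-1` B (lift ord0 i))).
    apply: fin_bigcap_measurable => // i _.
    by rewrite -[X in measurable X]setTI; exact: measurable_tnth.
  by apply/seteqP; split=> t /= Bt i; [move=> _; exact: Bt|exact: Bt].
rewrite /pushforward; congr (_ _).
apply/seteqP; split=> -[x t] /=.
  move=> H; split=> [|i]; first by have := H ord0.
  by have := H (lift ord0 i); rewrite tnthS.
move=> [Bx Bt] i; case: (unliftP ord0 i) => [j ->|->]; last by [].
by rewrite tnthS.
Qed.

End power_measure.
Arguments power_measure {d A R} mu n _.

Definition generated_subgroup (G : groupType) (S : set G) : set G :=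
  smallest [set H : set G | group_closed (mem H)] S.

(* The subspace topology on H is discrete. *)
Definition discrete_subset (X : topologicalType) (H : set X) := isolated H = H.

(* Main.v *)
(* Let [X] be the set of tuples whose [T]-components all fix a vertex [v], such
   that [a_1] is non-torsion on [T] and fixes a vertex [u] of [U], and [a_2]
   translates [u] along an axis through a fixed edge [uz].  Such translations
   have infinite measure: they contain pairwise disjoint left translates of one
   set of positive measure.
   - Discreteness fails because [a_1] has infinite order but finite orbits, so
     that powers of it fix any given finite set of vertices.
   - Compactness fails because [a_2] has an unbounded orbit.
   - Openness fails because the signs of the action on the spheres around [v]
     are homomorphisms to [F_2]; some nonzero combination of [n + 1] of them
     kills the [n] generators, hence the closure, although swapping two branches
     far from [v] gives automorphisms arbitrarily close to 1 that it detects.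
   Torsion is negligible in the stabilizer of [v]: if [g] has finite order and
   the orbit of [w] has maximal length [l], then [g ^ l] fixes the branch below
   [w] pointwise.  For fixed [w] and [l] the set of such [g] is null, since for
   [h] supported in the branch the first return of [h * g] to it is [h], so
   that the infinitely many translates of the set by such [h] are disjoint. *)
From HB Require Import structures.
Require Import Defs.
From mathcomp Require Import all_boot all_order all_algebra perm.
From mathcomp Require Import finmap.
From mathcomp Require Import all_classical all_reals all_analysis.
From mathcomp Require Import zify.

Set Implicit Arguments.
Unset Strict Implicit.
Unset Printing Implicit Defensive.

Import Order.TTheory GRing.Theory Num.Theory.

Local Open Scope classical_set_scope.

(** * Rooted regular trees *)

Section rooted.
Variables (T : regularTree) (v : T).
Implicit Types (x y z : T) (n : nat).

(** Made boolean so that [ex_minn] can pick the least length of a path. *)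
Definition reach n x := `[< exists2 p : seq T, path adj v p & last v p = x /\ size p = n >].

Lemma reach_ex x : exists n, reach n x.
Proof.
by have [p vp px] := tree_connected v x; exists (size p); apply/asboolP; exists p.
Qed.

Definition depth x := ex_minn (reach_ex x).

Lemma depth_le_path (p : seq T) : path adj v p -> depth (last v p) <= size p.
Proof.
move=> vp; rewrite /depth; case: ex_minnP => m _; apply.
by apply/asboolP; exists p.
Qed.

Lemma geodesic x :
  exists2 p : seq T, path adj v p & last v p = x /\ size p = depth x.
Proof. by rewrite /depth; case: ex_minnP => m /asboolP. Qed.

Lemma depth_root : depth v = 0.
Proof. by have := @depth_le_path [::] isT; rewrite leqn0 => /eqP. Qed.

Lemma depth_eq0 x : (depth x == 0) = (x == v).
Proof.
apply/eqP/eqP => [x0|->]; last exact: depth_root.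
by have [p _ []] := geodesic x; rewrite x0; case: p.
Qed.

Lemma depth_adj x y : adj x y -> depth y <= (depth x).+1.
Proof.
move=> xy; have [p vp [px <-]] := geodesic x.
have := @depth_le_path (rcons p y).
by rewrite last_rcons size_rcons rcons_path vp px; apply.
Qed.

Definition is_parent x y := adj x y /\ depth x = (depth y).+1.

Lemma parent_ex x : x != v -> exists y, is_parent x y.
Proof.
move=> xv; have [p vp [px sp]] := geodesic x.
case/lastP: p => [|p z] in vp px sp *; first by rewrite -px eqxx in xv.
move: vp px sp; rewrite rcons_path last_rcons size_rcons => /andP[vp zp] zx sp.
subst z; exists (last v p); split; first by rewrite adj_sym.
apply/eqP; rewrite eqn_leq depth_adj// -sp ltnS.
exact: depth_le_path.
Qed.

(** The root counts as its own parent, so that [par] is total and can be iterated. *)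
Definition par x : T := if pselect (x != v) is left xv then sval (cid (parent_ex xv)) else v.

Lemma par_root : par v = v.
Proof. by rewrite /par; case: pselect => // vv; case/negP: (vv). Qed.

Lemma parP x : x != v -> adj x (par x) /\ depth x = (depth (par x)).+1.
Proof. by rewrite /par; case: pselect => // xv _; exact: (svalP (cid (parent_ex xv))). Qed.

Lemma depth_par x : depth (par x) = (depth x).-1.
Proof.
have [->|/parP[_ ->]//] := eqVneq x v; by rewrite par_root depth_root.
Qed.

Lemma depth_iter_par n x : depth (iter n par x) = depth x - n.
Proof. by elim: n => [|n IH]; rewrite ?subn0//= depth_par IH subnS. Qed.

End rooted.

Lemma rel_path_trans (S : eqType) (e : rel S) x y z :
  (exists2 p, path e x p & last x p = y) ->
  (exists2 p, path e y p & last y p = z) ->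
  exists2 p, path e x p & last x p = z.
Proof.
move=> [p xp py] [q yq qz]; exists (p ++ q); rewrite ?last_cat ?py//.
by rewrite cat_path xp py yq.
Qed.

Lemma rel_path_sym (S : eqType) (e : rel S) x y : symmetric e ->
  (exists2 p, path e x p & last x p = y) ->
  exists2 p, path e y p & last y p = x.
Proof.
move=> se [p xp py]; exists (rev (belast x p)).
  by rewrite -py rev_path; under eq_path do rewrite se.
by case: p {xp} py => [|a p] //= _; rewrite rev_cons last_rcons.
Qed.

(** * Acyclicity and uniqueness of parents *)

Section acyclic.
Variable (T : regularTree).
Implicit Types x y z : T.

(* A shortest path avoiding the edge would close up with it to a cycle. *)
Lemma edge_bridge x y : adj x y ->
  ~ exists2 p, path [rel a b | adj a b && ((a, b) != (x, y)) && ((a, b) != (y, x))] x p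
      & last x p = y.
Proof.
move=> xy [p xp py]; case: (shortenP xp) py => q xq uq _ qy.
have xyN : x != y by apply: contraTneq xy => ->; rewrite adj_irrefl.
case: q => [|a [|b q]] in xq uq qy *.
- by move: xyN; rewrite -qy eqxx.
- by move: xq qy => /= + ay; rewrite ay eqxx andbF.
- apply: (@tree_acyclic T [:: x, a, b & q]) => //.
  rewrite /ucycle uq andbT /cycle rcons_path; apply/andP; split.
    by apply: sub_path xq => c d /= /andP[/andP[]].
  by rewrite qy adj_sym.
Qed.

Variable v : T.

(** Otherwise the chains of parents from [x] and from [y] to the root both avoid the edge [xy], and
    together they join its ends, against [edge_bridge]. *)
Lemma adj_par x y : adj x y -> (x != v /\ par v x = y) \/ (y != v /\ par v y = x).
Proof.
move=> xy; apply: contrapT => /not_orP[xNy yNx].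
pose e := [rel a b : T | adj a b && ((a, b) != (x, y)) && ((a, b) != (y, x))].
have se : symmetric e.
  by move=> a b /=; rewrite adj_sym -!andbA !xpair_eqE (andbC (b == x)) (andbC (b == y))
    (andbC (~~ _)).
have toroot z : exists2 p, path e z p & last z p = v.
  move: {2}(depth v z) (erefl (depth v z)) => n; elim: n z => [|n IH] z zn.
    by exists [::] => //=; apply/eqP; rewrite -(depth_eq0 v) zn.
  have zv : z != v by rewrite -(depth_eq0 v) zn.
  have [zp pz] := parP zv.
  apply: (@rel_path_trans _ _ _ (par v z)); last by apply: IH; rewrite depth_par zn.
  exists [:: par v z] => //=; rewrite andbT zp /= !xpair_eqE.
  apply/andP; split; apply/negP => /andP[/eqP zx /eqP pzy].
    by apply: xNy; subst x.
  by apply: yNx; subst y.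
apply: (edge_bridge xy); apply: rel_path_trans (toroot x) _.
exact: rel_path_sym (toroot y).
Qed.

Lemma adj_child x y : adj x y -> y != par v x -> y != v /\ par v y = x.
Proof. by move=> /adj_par[[_ ->]|//]; rewrite eqxx. Qed.

Lemma child_depth x y : adj x y -> y != par v x -> depth v y = (depth v x).+1.
Proof. by move=> xy yx; have [/parP[_ ->] ->] := adj_child xy yx. Qed.

Lemma par_uniq x y : adj x y -> depth v x = (depth v y).+1 -> par v x = y.
Proof.
move=> /adj_par[[]//|[yv <-]] /eqP; rewrite depth_par.
have : depth v y != 0 by rewrite depth_eq0.
by case: (depth v y) => //= n _; rewrite ltn_eqF//; exact: leqW.
Qed.

End acyclic.

Section neighbours.
Variable T : regularTree.
Implicit Types x y z : T.

Definition nbr x : set T := [set y | adj x y].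

Lemma finite_nbr x : finite_set (nbr x).
Proof. by exists (degree T); exact: tree_regular. Qed.

Lemma nbr_bij x y : exists f : T -> T, set_bij (nbr x) (nbr y) f.
Proof.
pose P : pointedType := HB.pack (Choice.sort T) (isPointed.Build T x).
apply: (@card_set_bijP _ P _ _ _).
exact: card_eq_trans (tree_regular x) (card_esym (tree_regular y)).
Qed.

End neighbours.

(** * Extension of automorphisms *)

Section swap.
Variable T : eqType.
Implicit Types a b x : T.

Definition swap a b : T -> T := fun x => if x == a then b else if x == b then a else x.

Lemma swapl a b : swap a b a = b.
Proof. by rewrite /swap /= eqxx. Qed.

Lemma swapr a b : swap a b b = a.
Proof. by rewrite /swap /= eqxx; case: eqP => // ->. Qed.

Lemma swap_id a b x : x != a -> x != b -> swap a b x = x.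
Proof. by rewrite /swap /= => /negPf-> /negPf->. Qed.

Lemma swapK a b : involutive (swap a b).
Proof.
move=> x; have [->|xa] := eqVneq x a; first by rewrite swapl swapr.
have [->|xb] := eqVneq x b; first by rewrite swapr swapl.
by rewrite !swap_id.
Qed.

Lemma swap_bij (A : set T) a b : A a -> A b -> set_bij A A (swap a b).
Proof.
move=> Aa Ab.
have As x : A x -> A (swap a b x) by rewrite /swap /=; do 2 case: ifP => //.
split=> //; first by move=> x y _ _; apply: can_inj (swapK a b) _ _.
by move=> x Ax; exists (swap a b x); [exact: As | rewrite swapK].
Qed.

End swap.

(** The last clause makes extensions built from these bijections trivial wherever nothing forces
    them to move. *)
Lemma nbr_bij_to (T : regularTree) (q e q' e' : T) : adj q e -> adj q' e' ->
  exists f : T -> T, [/\ set_bij (nbr q) (nbr q') f, f e = e' &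
    q = q' -> e = e' -> f = id].
Proof.
move=> qe qe'; have [[<- <-]|neq] := pselect (q = q' /\ e = e').
  by exists id; split=> //; split=> // x qx; exists x.
have [f fbij] := nbr_bij q q'; exists (swap (f e) e' \o f); split.
- apply: (set_bij_comp fbij); apply: (@swap_bij _ (nbr q') _ _ _ qe').
  by case: fbij => + _ _; apply.
- exact: swapl.
- by move=> qq ee; case: neq.
Qed.

(* A map that restricts to bijections between the neighbourhoods of each vertex
   and of its image is an automorphism of a regular tree, so [tau] may be chosen
   freely at each vertex [q] with parent [e] and their images [q'], [e']. *)
Section extension.
Variables (T : regularTree) (v v' : T) (pi : T -> T).
Variable tau : T -> T -> T -> T -> T -> T.
Hypothesis pi_bij : set_bij (nbr v) (nbr v') pi.
Hypothesis tau_bij : forall q e q' e', adj q e -> adj q' e' ->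
  set_bij (nbr q) (nbr q') (tau q e q' e') /\ tau q e q' e' e = e'.
Implicit Types x y z : T.

(** The value at [x] uses the images of its parent and its grandparent, hence the two-step
    recursion. Depth 1 is separate because the root has no parent to respect; [pi] decides there. *)
Fixpoint ext_rec n x : T :=
  match n with
  | 0 => v'
  | 1 => pi x
  | (m.+1 as k).+1 =>
    tau (par v x) (par v (par v x)) (ext_rec k (par v x))
      (ext_rec m (par v (par v x))) x
  end.

Definition ext x := ext_rec (depth v x) x.

Lemma ext_root : ext v = v'.
Proof. by rewrite /ext depth_root. Qed.

Lemma ext_nbr z : adj v z -> ext z = pi z.
Proof.
move=> vz; rewrite /ext (child_depth vz) ?depth_root//.
by rewrite par_root; apply: contraTneq vz => ->; rewrite adj_irrefl.
Qed.

Lemma ext_step x : x != v -> par v x != v ->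
  ext x = tau (par v x) (par v (par v x)) (ext (par v x)) (ext (par v (par v x))) x.
Proof.
move=> xv pxv; rewrite /ext.
have [_ ->] := parP xv; by have [_ ->] := parP pxv.
Qed.

Lemma ext_adj_par x : x != v -> adj (ext x) (ext (par v x)).
Proof.
move: {2}(depth v x) (erefl (depth v x)) => n; elim: n x => [|n IH] x xn xv.
  by move: xv; rewrite -(depth_eq0 v) xn.
have [xp px] := parP xv.
have [pxv|pxv] := eqVneq (par v x) v.
  rewrite pxv in xp *; rewrite ext_root ext_nbr adj_sym//.
  by case: pi_bij => + _ _; apply; rewrite /nbr /= adj_sym.
rewrite ext_step// adj_sym.
have [xpp _] := parP pxv.
have [[ts _ _] te] := @tau_bij (par v x) (par v (par v x)) (ext (par v x))
  (ext (par v (par v x))) xpp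
  (IH _ (eq_add_S _ _ (etrans (esym px) xn)) pxv).
by apply: ts; rewrite /nbr /= adj_sym.
Qed.

Lemma ext_local q : set_bij (nbr q) (nbr (ext q)) ext.
Proof.
have [->|qv] := eqVneq q v.
  rewrite ext_root; apply: (eq_set_bijLR _ pi_bij) => //.
  by move=> z /set_mem vz; rewrite ext_nbr.
have [qp _] := parP qv.
have [tb te] := tau_bij qp (ext_adj_par qv).
apply: (eq_set_bijLR _ tb) => //.
move=> z /set_mem qz; have [zp|zp] := eqVneq z (par v q); first by rewrite zp.
by have [zv pz] := adj_child qz zp; rewrite ext_step// pz.
Qed.

Lemma ext_adj x y : adj x y -> adj (ext x) (ext y).
Proof. by have [+ _ _] := ext_local x; apply. Qed.

(** Were the image of [x] the parent of the image of [par v x], injectivity around [par v x] would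
    identify [x] with its grandparent. This lets [ext_inj] compare preimages level by level. *)
Lemma ext_depth x : depth v' (ext x) = depth v x /\ par v' (ext x) = ext (par v x).
Proof.
move: {2}(depth v x) (erefl (depth v x)) => n; elim: n x => [|n IH] x xn.
  have -> : x = v by apply/eqP; rewrite -(depth_eq0 v) xn.
  by rewrite par_root ext_root par_root !depth_root.
have xv : x != v by rewrite -(depth_eq0 v) xn.
have [xp px] := parP xv.
have [dp pp] := IH _ (eq_add_S _ _ (etrans (esym px) xn)).
have gadj : adj (ext (par v x)) (ext x) by apply: ext_adj; rewrite adj_sym.
suff neq : ext x != par v' (ext (par v x)).
  by rewrite (child_depth gadj neq) dp px; have [_ ->] := adj_child gadj neq.
have [pxv|pxv] := eqVneq (par v x) v.
  rewrite pxv ext_root par_root; apply: contraTneq gadj => ->.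
  by rewrite pxv ext_root adj_irrefl.
rewrite pp; apply/eqP => exx; have [_ /(_ x (par v (par v x))) inj _] := ext_local (par v x).
have [xpp ppx] := parP pxv.
have xx : x = par v (par v x) by apply: inj => //; rewrite inE// /nbr /= adj_sym.
by move: px; rewrite {1}xx ppx => /eqP; rewrite ltn_eqF//; exact: leqW.
Qed.

Lemma ext_inj : injective ext.
Proof.
move=> x; move: {2}(depth v x) (erefl (depth v x)) => n.
elim: n x => [|n IH] x xn y xy.
  have yn : depth v y = 0 by have [<- _] := ext_depth y; rewrite -xy; have [-> _] := ext_depth x.
  by transitivity v; [|symmetry]; apply/eqP; rewrite -(depth_eq0 v) ?xn ?yn.
have xv : x != v by rewrite -(depth_eq0 v) xn.
have yv : y != v.
  rewrite -(depth_eq0 v); have [<- _] := ext_depth y; rewrite -xy.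
  by have [-> _] := ext_depth x; rewrite xn.
have [xp px] := parP xv; have [yp py] := parP yv.
have pp : par v x = par v y.
  apply: IH; first by apply: eq_add_S; rewrite -px.
  by have [_ <-] := ext_depth x; have [_ <-] := ext_depth y; rewrite xy.
have [_ /(_ x y) inj _] := ext_local (par v x).
by apply: inj => //; rewrite inE /nbr /= adj_sym// pp.
Qed.

Lemma ext_surj y : exists x, ext x = y.
Proof.
move: {2}(depth v' y) (erefl (depth v' y)) => n; elim: n y => [|n IH] y yn.
  by exists v; rewrite ext_root; apply/esym/eqP; rewrite -(depth_eq0 v') yn.
have yv : y != v' by rewrite -(depth_eq0 v') yn.
have [yp py] := parP yv.
have [q qy] := IH _ (eq_add_S _ _ (etrans (esym py) yn)).
have [_ _ /(_ y)[|z _ <-]] := ext_local q; last by exists z.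
by rewrite /nbr /= qy adj_sym.
Qed.

Lemma ext_is_aut : is_aut ext.
Proof.
apply/asboolP; split.
  pose f y := sval (cid (ext_surj y)).
  have fP y : ext (f y) = y by exact: svalP (cid (ext_surj y)).
  by exists f => // x; apply: ext_inj.
move=> x y; apply/idP/idP => [gxy|]; last exact: ext_adj.
have [_ _ /(_ (ext y))[|z xz /ext_inj zy]] := ext_local x; first by [].
by move: xz; rewrite -zy.
Qed.

End extension.

Lemma tree_ext (T : regularTree) (v v' : T) (pi : T -> T) (tau : T -> T -> T -> T -> T -> T) :
  set_bij (nbr v) (nbr v') pi ->
  (forall q e q' e', adj q e -> adj q' e' ->
    set_bij (nbr q) (nbr q') (tau q e q' e') /\ tau q e q' e' e = e') ->
  exists g : aut T, [/\ g v = v', forall z, adj v z -> g z = pi z &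
    forall x, x != v -> par v x != v ->
      g x = tau (par v x) (par v (par v x)) (g (par v x)) (g (par v (par v x))) x].
Proof.
move=> pib taub; exists (Aut (ext_is_aut pib taub)); split=> /=.
- exact: ext_root.
- exact: ext_nbr.
- exact: ext_step.
Qed.

(** * Transitivity on edges and swaps of branches *)

Section tree_automorphisms.
Variable T : regularTree.
Implicit Types x y z : T.

Definition nbr_to q e q' e' : T -> T :=
  if pselect (adj q e /\ adj q' e') is left H then sval (cid (nbr_bij_to H.1 H.2)) else id.

Lemma nbr_toP q e q' e' : adj q e -> adj q' e' ->
  set_bij (nbr q) (nbr q') (nbr_to q e q' e') /\ nbr_to q e q' e' e = e'.
Proof.
rewrite /nbr_to; case: pselect => [[qe qe'] _ _|nH qe qe']; last by case: nH.
by case: cid => f /= [].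
Qed.

Lemma nbr_to_id q e : nbr_to q e q e = id.
Proof.
by rewrite /nbr_to; case: pselect => // -[qe qe']; case: cid => f /= [_ _ ->].
Qed.

Lemma aut_transitive v z v' z' : adj v z -> adj v' z' ->
  exists g : aut T, g v = v' /\ g z = z'.
Proof.
move=> vz vz'; have [pib pz] := nbr_toP vz vz'.
have [g [gv gn _]] := tree_ext pib nbr_toP.
by exists g; split=> //; rewrite gn.
Qed.

(** The branch below [w], including [w] itself ([n = 0]). *)
Definition desc v w x := exists n, iter n (par v) x = w.

(** Extend the identity around [v], swapping [a] and [b] at [w] and using [nbr_to] elsewhere. By
    [nbr_to_id] nothing moves until the branches at [a] and [b] are entered. *)
Lemma aut_swap_children v w a b : w != v ->
  adj w a -> adj w b -> a != par v w -> b != par v w ->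
  exists g : aut T, [/\ g a = b, g b = a &
    forall x, ~ desc v a x -> ~ desc v b x -> g x = x].
Proof.
move=> wv wa wb aw bw.
(* The swap is prescribed only where [w] and its parent are fixed; elsewhere it need not map into
   the right neighbourhood. *)
pose tau q e q' e' := if [&& q == w, q' == w, e == par v w & e' == par v w]
  then swap a b else nbr_to q e q' e'.
have taub q e q' e' : adj q e -> adj q' e' ->
    set_bij (nbr q) (nbr q') (tau q e q' e') /\ tau q e q' e' e = e'.
  move=> qe qe'; rewrite /tau; case: ifPn => [|_]; last exact: nbr_toP.
  move=> /and4P[/eqP-> /eqP-> /eqP-> /eqP->]; split; first exact: swap_bij.
  by rewrite swap_id// eq_sym.
have idb : set_bij (nbr v) (nbr v) (@id T) by split=> // x vx; exists x.
have [g [gv gn gs]] := tree_ext idb taub.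
have [av pa] := adj_child wa aw; have [bv pb] := adj_child wb bw.
have gfix x : ~ desc v a x -> ~ desc v b x -> g x = x.
  move: {2}(depth v x) (erefl (depth v x)) => n.
  elim/ltn_ind: n x => n IH x xn xa xb.
  have [->//|xv] := eqVneq x v.
  have [xp px] := parP xv.
  have [pxv|pxv] := eqVneq (par v x) v; first by rewrite gn// -pxv adj_sym.
  have [xpp ppx] := parP pxv.
  have gp : g (par v x) = par v x.
    apply: (IH (depth v (par v x))) => //; first by rewrite -xn px.
      by move=> [m xm]; apply: xa; exists m.+1; rewrite iterSr.
    by move=> [m xm]; apply: xb; exists m.+1; rewrite iterSr.
  have gpp : g (par v (par v x)) = par v (par v x).
    apply: (IH (depth v (par v (par v x)))) => //; first by rewrite -xn px ppx leqW.
      by move=> [m xm]; apply: xa; exists m.+2; rewrite !iterSr.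
    by move=> [m xm]; apply: xb; exists m.+2; rewrite !iterSr.
  rewrite gs// gp gpp /tau; case: ifP => _; last by rewrite nbr_to_id.
  rewrite swap_id//.
    by apply/eqP => xa'; apply: xa; exists 0.
  by apply/eqP => xb'; apply: xb; exists 0.
have ndesc x : depth v x <= depth v w -> ~ desc v a x /\ ~ desc v b x.
  have [_ da] := parP av; have [_ db] := parP bv; rewrite pa in da; rewrite pb in db.
  move=> xw; split=> -[n] /(congr1 (depth v)); rewrite depth_iter_par ?da ?db => xwn.
    by move: xw; rewrite leqNgt -xwn; lia.
  by move: xw; rewrite leqNgt -xwn; lia.
have gw : g w = w by have [] := ndesc w (leqnn _); exact: gfix.
have gpw : g (par v w) = par v w.
  by have [] := @ndesc (par v w); [rewrite depth_par leq_pred|exact: gfix].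
exists g; split=> //.
  by rewrite gs ?pa// gw gpw /tau !eqxx /= swapl.
by rewrite gs ?pb// gw gpw /tau !eqxx /= swapr.
Qed.

End tree_automorphisms.

(** * Automorphisms and a base vertex *)

Section aut_rooted.
Variable T : regularTree.
Implicit Types (v w x y z p : T) (g h : aut T) (n k : nat).

Lemma aut_injective g : injective g.
Proof. exact: bij_inj (aut_bij g). Qed.

Lemma autM g h x : (g * h)%g x = g (h x).
Proof. by []. Qed.

Lemma autK g : cancel g (g^-1)%g.
Proof. by move=> x; rewrite -autM mulVg. Qed.

Lemma autVK g : cancel (g^-1)%g g.
Proof. by move=> x; rewrite -autM mulgV. Qed.

Lemma aut_expE g n x : (g ^+ n)%g x = iter n g x.
Proof. by elim: n => // n IH; rewrite expgS /= -IH. Qed.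

Lemma aut_depth_le g v x : depth (g v) (g x) <= depth v x.
Proof.
have [p vp [<- <-]] := geodesic v x.
rewrite -last_map -(size_map g); apply: depth_le_path.
by rewrite path_map; apply: sub_path vp => a b /=; rewrite aut_adj.
Qed.

Lemma aut_depth g v x : depth (g v) (g x) = depth v x.
Proof.
apply/eqP; rewrite eqn_leq aut_depth_le /=.
by rewrite -{1}[v](autK g) -{1}[x](autK g) aut_depth_le.
Qed.

Lemma aut_par g v x : par (g v) (g x) = g (par v x).
Proof.
have [->|xv] := eqVneq x v; first by rewrite !par_root.
by have [xp dx] := parP xv; apply: par_uniq; rewrite ?aut_adj ?aut_depth.
Qed.

Lemma iter_aut_fix g v n : g v = v -> iter n g v = v.
Proof. by move=> gv; elim: n => //= n ->. Qed.

Lemma iter_aut_depth g v n x : g v = v -> depth v (iter n g x) = depth v x.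
Proof. by move=> gv; elim: n => //= n <-; rewrite -{1}gv aut_depth. Qed.

Lemma iter_aut_par g v n m x : g v = v ->
  iter m (par v) (iter n g x) = iter n g (iter m (par v) x).
Proof.
move=> gv; rewrite -!aut_expE; have : (g ^+ n)%g v = v by rewrite aut_expE iter_aut_fix.
move: (g ^+ n)%g => {gv}g gv.
by elim: m => //= m ->; rewrite -{1}gv aut_par.
Qed.

(** As [w] has nonzero depth, the truncated subtraction in [depth_iter_par] has not been cut off at
    0. *)
Lemma desc_depth v w x n : w != v -> iter n (par v) x = w ->
  n + depth v w = depth v x.
Proof.
rewrite -(depth_eq0 v) => w0 xw; have := depth_iter_par v n x.
by rewrite xw; lia.
Qed.

Lemma finite_sphere v n : finite_set [set x | depth v x = n].
Proof.
elim: n => [|n IH].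
  apply: sub_finite_set (finite_set1 v) => x /= /eqP.
  by rewrite depth_eq0 => /eqP.
apply: (@sub_finite_set _ _ (\bigcup_(x in [set x | depth v x = n]) nbr x)).
  move=> x /= xn; have xv : x != v by rewrite -(depth_eq0 v) xn.
  have [xp px] := parP xv; exists (par v x); last by rewrite /nbr /= adj_sym.
  by apply: eq_add_S; rewrite -px.
by apply: bigcup_finite => // x _; exact: finite_nbr.
Qed.

(** The orbit stays in a finite sphere around [v]; without a return, the iterates would embed [nat]
    into it. *)
Lemma finite_orbit g v x : g v = v -> exists2 k, 0 < k & iter k g x = x.
Proof.
move=> gv; apply: contrapT => nk.
have inj : injective (fun k => iter k g x).
  have iter_lt i j : i < j -> iter i g x <> iter j g x.
    move=> ij; rewrite -(subnKC (ltnW ij)) iterD -!aut_expE => /aut_injective.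
    by rewrite aut_expE => /esym xx; apply: nk; exists (j - i) => //; rewrite subn_gt0.
  by move=> i j /= ij; case: (ltngtP i j) => // /iter_lt; rewrite ij.
apply: infinite_nat.
apply: sub_finite_set (finite_preimage (in2W inj) (finite_sphere v (depth v x))).
by move=> k _ /=; rewrite iter_aut_depth.
Qed.

(** Of three neighbours at most one equals [p]. With [p] the parent of [w], this yields two distinct
    children. *)
Lemma three_nbrs w p : 3 <= degree T ->
  exists a b, [/\ adj w a, adj w b, a != p, b != p & a != b].
Proof.
move=> d3; pose P : pointedType := HB.pack (Choice.sort T) (isPointed.Build T w).
have /(@card_set_bijP _ P)[f [fn fi _]] := card_esym (tree_regular w).
have fadj i : i < 3 -> adj w (f i) by move=> i3; apply: fn; exact: leq_trans i3 d3.
have finj i j : i < 3 -> j < 3 -> i != j -> f i != f j.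
  move=> i3 j3; apply: contra_neq; apply: fi; rewrite inE/=; exact: leq_trans d3.
have [f0|f0] := eqVneq (f 0) p.
  by exists (f 1), (f 2); split; rewrite -?f0 ?fadj ?finj.
have [f1|f1] := eqVneq (f 1) p.
  by exists (f 0), (f 2); split; rewrite -?f1 ?fadj ?finj.
by exists (f 0), (f 1); split; rewrite ?fadj ?finj.
Qed.

Lemma ray v w : 3 <= degree T -> exists y : nat -> T, y 0 = w /\
  forall n, y n.+1 != v /\ par v (y n.+1) = y n.
Proof.
move=> d3; have /choice[c cP] x : exists c, c != v /\ par v c = x.
  have [a [_ [xa _ ap _ _]]] := three_nbrs x (par v x) d3.
  by exists a; exact: adj_child.
by exists (fun n => iter n c w); split=> // n; exact: cP.
Qed.

(** The automorphism [h k] swaps the branches at two children of the [k]-th vertex of a ray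
    descending from [w]. The first level that it moves thus lies deeper as [k] grows, which
    separates the [h k] from each other. *)
Lemma branch_swaps v w : 3 <= degree T -> w != v -> exists h : nat -> aut T,
  (forall k x, ~ desc v w x -> h k x = x) /\
  forall k, exists a b, [/\ a != b, desc v w a,
    depth v a = (depth v w + k).+1, depth v b = (depth v w + k).+1 &
    [/\ h k a = b, h k b = a &
    forall x, depth v x <= (depth v w + k).+1 -> x != a -> x != b -> h k x = x]].
Proof.
move=> d3 wv; have [y [y0 yS]] := ray v w d3.
have yv k : y k != v by case: k => [|k]; [rewrite y0|have [] := yS k].
have yw k : iter k (par v) (y k) = w.
  by elim: k => // k IH; rewrite iterSr; have [_ ->] := yS k.
have ydepth k : depth v (y k) = depth v w + k.
  by rewrite addnC; rewrite (desc_depth wv (yw k)).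
have /choice[h hP] k : exists h : aut T, (forall x, ~ desc v w x -> h x = x) /\
   exists a b, [/\ a != b, desc v w a,
    depth v a = (depth v w + k).+1, depth v b = (depth v w + k).+1 &
    [/\ h a = b, h b = a &
    forall x, depth v x <= (depth v w + k).+1 -> x != a -> x != b -> h x = x]].
  have [a [b [ya yb ap bp ab]]] := three_nbrs (y k) (par v (y k)) d3.
  have [h [ha hb hfix]] := aut_swap_children (yv k) ya yb ap bp.
  have [av pa] := adj_child ya ap; have [bv pb] := adj_child yb bp.
  have child_desc c : par v c = y k -> iter k.+1 (par v) c = w.
    by move=> pc; rewrite iterSr pc.
  have da : depth v a = (depth v w + k).+1 by rewrite (child_depth ya ap) ydepth.
  have db : depth v b = (depth v w + k).+1 by rewrite (child_depth yb bp) ydepth.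
  exists h; split.
    move=> x xw; apply: hfix => -[n xn]; apply: xw; exists (k.+1 + n);
      by rewrite iterD xn child_desc.
  exists a, b; split=> //; first by exists k.+1; exact: child_desc.
  split=> // x xk /eqP xa /eqP xb; apply: hfix => -[n xn].
    by case: n xn => [/xa//|n] /(desc_depth av); move: xk; rewrite da; lia.
  by case: n xn => [/xb//|n] /(desc_depth bv); move: xk; rewrite db; lia.
by exists h; split=> k; [have [] := hP k|have [_] := hP k].
Qed.

End aut_rooted.

(** * Translations along an axis *)

Section hyperbolic.
Variables (T : regularTree) (u z : T) (b : aut T).
(** Together these put [u], [z], [b u], [b z] in this order on a geodesic (possibly with [z = b u]),
    so that [b] translates along an axis through the edge [uz]. *)
Hypotheses (uz : adj u z) (bu : desc u z (b u)) (bz : b z != par u (b u)).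

Let zu : z != u.
Proof. by apply: contraTneq uz => ->; rewrite adj_irrefl. Qed.

Let pz : par u z = u.
Proof. by have [] := adj_child uz (_ : z != par u u); rewrite // par_root. Qed.

Let dz : depth u z = 1.
Proof. by have [_ ->] := parP zu; rewrite pz depth_root. Qed.

Lemma desc_not_root x : desc u z x -> x != u.
Proof.
move=> zx; apply/eqP => xu; move: zx; rewrite xu => -[n]; have -> : iter n (par u) u = u.
  by elim: n => //= n ->; rewrite par_root.
by move=> zu'; move: zu; rewrite zu' eqxx.
Qed.

(** Induction on depth: once [b] respects the parent of [par u x], injectivity keeps [b x] from
    being the parent of [b (par u x)], so it is a child. *)
Lemma hyperbolic_step x : desc u z x -> desc u z (b x) /\
  [/\ b x != u, par u (b x) = b (par u x) & depth u (b x) = depth u x + depth u (b u)].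
Proof.
move: {2}(depth u x) (erefl (depth u x)) => n; elim: n x => [|n IH] x xn zx.
  by have := desc_not_root zx; rewrite -(depth_eq0 u) xn.
have xu := desc_not_root zx; have [xp dx] := parP xu.
have badj : adj (b (par u x)) (b x) by rewrite aut_adj adj_sym.
have [xz|xz] := eqVneq x z.
  rewrite xz pz in badj *; have [bxu pb] := adj_child badj bz.
  split; first by have [k bk] := bu; exists k.+1; rewrite iterSr pb.
  by split=> //; rewrite (child_depth badj bz) dz.
have zpx : desc u z (par u x).
  have [[|k] xk] := zx; first by rewrite -xk eqxx in xz.
  by exists k; rewrite -iterSr.
have [zbp [bpu pb db]] := IH _ (eq_add_S _ _ (etrans (esym dx) xn)) zpx.
have bxp : b x != par u (b (par u x)).
  rewrite pb; apply/eqP => /aut_injective xx.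
  by move: dx; rewrite {1}xx depth_par depth_par; lia.
have [bxu pbx] := adj_child badj bxp.
split; first by have [k bk] := zbp; exists k.+1; rewrite iterSr pbx.
by split=> //; rewrite (child_depth badj bxp) db dx.
Qed.

Lemma hyperbolic_depth n : depth u (iter n b u) = n * depth u (b u).
Proof.
case: n => [|n]; first by rewrite mul0n depth_root.
suff: desc u z (iter n.+1 b u) /\ depth u (iter n.+1 b u) = n.+1 * depth u (b u).
  by case.
elim: n => [|n [zn dn]]; first by rewrite mul1n.
by have [zb [_ _ db]] := hyperbolic_step zn; split=> //; rewrite iterS db dn mulSn addnC.
Qed.

Lemma hyperbolic_orbit : injective (fun n => iter n b u).
Proof.
have := desc_not_root bu; rewrite -(depth_eq0 u) -lt0n => r0 i j /(congr1 (depth u)).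
by rewrite !hyperbolic_depth => /eqP; rewrite eqn_pmul2r// => /eqP.
Qed.

End hyperbolic.

(** * Torsion in the stabilizer of a vertex *)

Section torsion.
Variables (T : regularTree) (v : T).
Implicit Types (w x : T) (g h : aut T).

(** The elements whose first return to the branch at [w], at time [l], is the identity. *)
Definition branch_torsion w l : set (aut T) :=
  [set g | [/\ g v = v, forall x, desc v w x -> iter l g x = x &
     forall i, 0 < i < l -> iter i g w <> w]].

(** Choose [w] with the longest period [l]; periods are bounded by [m]. A descendant of [w] returns
    only when [w] does, so its period is at least [l], and by maximality equal to [l]. *)
Lemma torsion_branch g m : 3 <= degree T -> g v = v -> 0 < m ->
  (forall x, iter m g x = x) ->
  exists w l, [/\ w != v, 0 < l & branch_torsion w l g].
Proof.
move=> d3 gv m0 gm.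
pose per w l := [/\ 0 < l, iter l g w = w & forall i, 0 < i < l -> iter i g w <> w].
have per_ex w : exists2 l, l <= m & per w l.
  have ex : exists l, (0 < l) && (iter l g w == w) by exists m; rewrite m0 gm eqxx.
  case: (ex_minnP ex) => l /andP[l0 /eqP lw] lmin; exists l.
    by apply: lmin; rewrite m0 gm eqxx.
  split=> // i /andP[i0 il] iw; have := lmin i; rewrite i0 iw eqxx => /(_ isT).
  by rewrite leqNgt il.
pose P l := `[< exists2 w, w != v & per w l >].
have exP : exists l, P l.
  have [a [_ [va _ av _ _]]] := three_nbrs v v d3.
  by have [l _ al] := per_ex a; exists l; apply/asboolP; exists a.
have Pm l : P l -> l <= m.
  move=> /asboolP[w wv [l0 lw lmin]]; rewrite leqNgt; apply/negP => ml.
  by apply: (lmin m) (gm w); rewrite m0 ml.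
case: (ex_maxnP exP Pm) => l /asboolP[w wv [l0 lw lmin]] lmax.
exists w, l; split=> //; split=> // x [n xw].
have xv : x != v.
  apply: contraNneq wv => xv; rewrite -xw xv; apply/eqP.
  by elim: n {xw} => //= n ->; rewrite par_root.
have [k _ [k0 kx kmin]] := per_ex x.
have kl : k <= l by apply: lmax; apply/asboolP; exists x.
suff lk : l <= k by have -> : l = k by [lia].
rewrite leqNgt; apply/negP => klt; apply: (lmin k); first by rewrite k0 klt.
by rewrite -xw -iter_aut_par// kx.
Qed.

(* The points [g ^ i x], [0 < i < l], lie outside the branch at [w], where [h]
   is trivial. *)
Lemma branch_torsion_return w l g h x : w != v -> 0 < l -> branch_torsion w l g ->
  (forall y, ~ desc v w y -> h y = y) -> desc v w x ->
  iter l (h * g)%g x = h x.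
Proof.
move=> wv l0 [gv gl gw] hfix wx.
have small i : i < l -> iter i (h * g)%g x = iter i g x.
  elim: i => // i IH il; rewrite iterS IH ?(ltnW il)//.
  rewrite autM hfix// => -[n]; rewrite -iterS => xn.
  have [k xk] := wx.
  (* As [g] preserves depth, both descents from [w] have the same length; then [g ^ i.+1] would fix
     [w] too early. *)
  have kn : k = n.
    have := desc_depth wv xn; have := desc_depth wv xk.
    by rewrite iter_aut_depth//; lia.
  by apply: (gw i.+1) => //; rewrite -{1}xk kn -iter_aut_par.
case: l l0 small gl {gw} => // l _ small gl.
by rewrite iterS small// autM -iterS gl.
Qed.

End torsion.

Local Open Scope ring_scope.

(** * Topology and Haar measure *)

Section aut_topology.
Variable T : regularTree.
Implicit Types (g h : aut T) (V : set (aut T)).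

Definition agree_filter g : set_system (aut T) :=
  [set V | exists s : seq T, forall h, {in s, h =1 g} -> V h].

Lemma agree_filterP g : Filter (agree_filter g).
Proof.
split; first by exists [::].
- move=> A B [s sA] [t tB]; exists (s ++ t) => h hst; split.
    by apply: sA => x xs; apply: hst; rewrite mem_cat xs.
  by apply: tB => x xt; apply: hst; rewrite mem_cat xt orbT.
- by move=> A B AB [s sA]; exists s => h /sA /AB.
Qed.

(** One direction holds because the filter of agreement on finite sets converges to [g] at each
    vertex, the other because agreement at one vertex is an open condition. *)
Lemma aut_nbhsP g V :
  nbhs g V <-> exists s : seq T, forall h, {in s, h =1 g} -> V h.
Proof.
split.
  case=> B [[A oA <-] Ag] BV.
  have FF : Filter (agree_filter g) := agree_filterP g.
  suff cv : (@aut_ptws T) @ agree_filter g --> aut_ptws g.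
    have : nbhs (aut_ptws g) A by apply: open_nbhs_nbhs.
    by move=> /cv [s sA]; exists s => h /sA /BV.
  apply/cvg_sup => i W [_ [[C oC <-] Cg] CW].
  by exists [:: i] => h hg; apply: CW; rewrite /= /aut_ptws hg ?inE.
move=> [s sV]; apply: (@filterS _ _ _ (fun h => {in s, h =1 g})) => //.
elim: s {sV} => [|a s IH]; first by apply: filterS filterT => h _ x; rewrite inE.
have ga : nbhs g [set h : aut T | h a = g a].
  by apply: open_nbhs_nbhs; split=> //; exact: aut_open_eval.
apply: filterS (filterI ga IH) => h [ha hs] x.
by rewrite inE => /predU1P[->//|]; exact: hs.
Qed.

Lemma aut_openP V : open V <-> forall g, V g -> exists s : seq T, forall h, {in s, h =1 g} -> V h.
Proof.
rewrite openE; split=> oV g Vg; first by apply/aut_nbhsP/oV.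
exact/aut_nbhsP/oV.
Qed.

Lemma aut_open_mull g V : open V -> open [set h : aut T | V (g * h)%g].
Proof.
move=> /aut_openP oV; apply/aut_openP => h /= /oV[s sV]; exists s => k kh.
by apply: sV => x xs; rewrite !autM (kh x xs).
Qed.

Lemma aut_measurable_mull g V : measurable V -> measurable [set h : aut T | V (g * h)%g].
Proof.
move: V; suff : measurable_fun setT (fun h : aut T => (g * h)%g).
  by move=> mg V mV; have := mg measurableT V mV; rewrite setTI.
apply: (measurability (@open (aut T))) => //.
by move=> _ [A oA <-]; rewrite setTI; apply: sub_sigma_algebra; exact: aut_open_mull.
Qed.

Lemma open_measurable_aut V : open V -> measurable V.
Proof. exact: sub_sigma_algebra. Qed.

Lemma aut_open_iter n (x y : T) : open [set g : aut T | iter n g x = y].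
Proof.
(* Agreement with [g] on the first [n] points of the [g]-orbit of [x] determines the [n]-th
   iterate. *)
apply/aut_openP => g gxy; exists [seq iter i g x | i <- iota 0 n] => h hg /=.
rewrite -gxy; suff : forall m, (m <= n)%N -> iter m h x = iter m g x by apply.
elim=> // m IH mn; rewrite !iterS IH ?(ltnW mn)// hg//.
by apply/mapP; exists m => //; rewrite mem_iota.
Qed.

End aut_topology.

(** * Infinite measure from disjoint translates *)

Section haar_translate.
Variables (R : realType) (T : regularTree) (mu : haarMeasure R T).

Lemma haar_mull g (A : set (aut T)) : measurable A ->
  haar mu [set h | A (g * h)%g] = haar mu A.
Proof.
move=> mA; rewrite -[RHS](haar_left_invariant mu g^-1%g mA) /haar; congr (_ _).
apply/seteqP; split=> [h Ah|_ [h Ah <-]] /=; last by rewrite mulVKg.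
by exists (g * h)%g => //; rewrite mulKg.
Qed.

Lemma haar_disjoint_translates (h : nat -> aut T) (A B : set (aut T)) :
  measurable A -> measurable B -> (0 < haar mu A)%E ->
  (forall k g, A (h k * g)%g -> B g) ->
  (forall k l g, A (h k * g)%g -> A (h l * g)%g -> k = l) ->
  haar mu B = +oo%E.
Proof.
move=> mA mB A0 AB disj.
pose F k := [set g | A (h k * g)%g].
have mF k : measurable (F k) by exact: aut_measurable_mull.
have tF : trivIset setT F.
  by move=> k l _ _ [g [kg lg]]; exact: disj kg lg.
have muF k : haar mu (F k) = haar mu A by exact: haar_mull.
have bound n : ((n%:R%:E * haar mu A) <= haar mu B)%E.
  have -> : (n%:R%:E * haar mu A = haar mu (\big[setU/set0]_(k < n) F k))%E.
    rewrite measure_bigsetU//.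
    rewrite (eq_bigr (fun=> haar mu A)) => [|i _]; last exact: muF.
    by rewrite sumr_const card_ord mule_natl.
  apply: le_measure; rewrite ?inE//; first exact: bigsetU_measurable.
  by rewrite -bigcup_mkord => g [k _]; exact: AB.
(* The bound for one translate settles the case where [A] has infinite measure. *)
have := bound 1%N; rewrite mul1e; move: bound A0.
have : (0 <= haar mu A)%E by exact: measure_ge0.
case: (haar mu A) (haar mu B) => [c| |] [b| |] //= c0 bound cpos _.
rewrite lte_fin in cpos.
(* With finite measures, this many translates exceed the measure of [B]. *)
have /= := bound (Num.truncn (b / c)).+1.
rewrite -EFinM lee_fin leNgt -ltr_pdivrMr// => /negP[].
exact: truncnS_gt.
Qed.

End haar_translate.

Lemma aut_closed_iter (T : regularTree) n (x y : T) :
  closed [set g : aut T | iter n g x = y].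
Proof.
rewrite -openC; have -> : ~` [set g : aut T | iter n g x = y] =
    \bigcup_(z in [set z | z <> y]) [set g : aut T | iter n g x = z].
  apply/seteqP; split=> [g gxy|g [z zy /= gz]] /=; last by rewrite gz.
  by exists (iter n g x).
by apply: bigcup_open => z _; exact: aut_open_iter.
Qed.

Lemma closed_measurable_aut (T : regularTree) (V : set (aut T)) : closed V -> measurable V.
Proof.
move=> cV; rewrite -[V]setCK; apply: measurableC; apply: open_measurable_aut.
exact: closed_openC.
Qed.

Lemma measurable_stabilizer (T : regularTree) (v : T) : measurable (stabilizer v).
Proof. by apply: open_measurable_aut; exact: (aut_open_eval v v). Qed.

(** * Torsion is negligible *)

Section torsion_measure.
Variables (R : realType) (T : regularTree) (mu : haarMeasure R T) (v : T).
Hypothesis d3 : (3 <= degree T)%N.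

Lemma branch_torsion_closed w l : closed (branch_torsion v w l).
Proof.
have -> : branch_torsion v w l = [set g | iter 1 g v = v] `&`
   \bigcap_(x in desc v w) [set g | iter l g x = x] `&`
   \bigcap_(i in [set i | (0 < i < l)%N]) ~` [set g | iter i g w = w].
  by apply/seteqP; split=> [g [gv gl gw]|g [[gv gl] gw]].
apply: closedI; first apply: closedI.
- exact: aut_closed_iter.
- by apply: closed_bigI => x _; exact: aut_closed_iter.
- by apply: closed_bigI => i _; apply: open_closedC; exact: aut_open_iter.
Qed.

(** If the measure were positive, the translates by the swaps [h k] would be infinitely many
    disjoint sets of equal positive measure in the stabilizer of [v], which has measure 1. *)
Lemma haar_branch_torsion w l : w != v -> (0 < l)%N ->
  haar mu (branch_torsion v w l) = 0%E.
Proof.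
move=> wv l0; apply/eqP; rewrite eq_le measure_ge0 andbT leNgt; apply/negP => pos.
have [h [hfix hswap]] := branch_swaps d3 wv.
have hv k : h k v = v.
  apply: hfix => -[n]; have -> : iter n (par v) v = v.
    by elim: n => //= n ->; rewrite par_root.
  by move=> vw; rewrite vw eqxx in wv.
suff : haar mu (stabilizer v) = +oo%E.
  by move=> soo; have := haar_stabilizer mu v; rewrite -[X in X = _]/(haar mu _) soo.
apply: (@haar_disjoint_translates R T mu (fun k => (h k)^-1%g) _ _ _ _ pos).
- apply: closed_measurable_aut; exact: branch_torsion_closed.
- exact: measurable_stabilizer.
- by move=> k g [gv _ _]; rewrite /stabilizer /= -{2}(hv k) -{2}gv autM autVK.
move=> k j g Ak Aj.
(* An element [g] of the [i]-th translate has first return [h i] to the branch, so [g] determines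
   [h i] there. *)
have swap_at i p : branch_torsion v w l ((h i)^-1 * g)%g -> desc v w p ->
    iter l g p = h i p.
  move=> Ai wp; rewrite -(branch_torsion_return wv l0 Ai (hfix i) wp).
  by rewrite mulVKg.
(* The vertex [a] moved by [h i] lies above everything that [h m] moves. *)
have key i m : (i < m)%N -> branch_torsion v w l ((h i)^-1 * g)%g ->
    branch_torsion v w l ((h m)^-1 * g)%g -> False.
  move=> im Ai Am.
  have [a [b [ab wa da db [ha _ _]]]] := hswap i.
  have [a' [b' [_ _ da' db' [_ _ hid]]]] := hswap m.
  have := swap_at _ _ Am wa; rewrite (swap_at _ _ Ai wa) ha hid.
  - by move=> ba; rewrite ba eqxx in ab.
  - by rewrite da; lia.
  - by apply/eqP => aa; move: da'; rewrite -aa da; lia.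
  - by apply/eqP => aa; move: db'; rewrite -aa da; lia.
case: (ltngtP k j) => // kj; [case: (key k j kj Ak Aj)|case: (key j k kj Aj Ak)].
Qed.

Definition torsion : set (aut T) :=
  \bigcup_m \bigcap_x [set g | iter m.+1 g x = x].

Lemma torsion_measurable : measurable torsion.
Proof.
apply: bigcupT_measurable => m; apply: closed_measurable_aut.
by apply: closed_bigI => x _; exact: aut_closed_iter.
Qed.

Lemma haar_nontorsion : haar mu (stabilizer v `\` torsion) = 1%E.
Proof.
have mS : measurable (stabilizer v) := measurable_stabilizer v.
have [f finj] : exists f : T -> nat, injective f.
  have /countable_injP[f finj] := countable_tree T.
  by exists f => x y fxy; apply: finj; rewrite ?inE.
(* Indices that code no vertex give the default [v], which the guard [e k != v] below discards. *)
pose e n := xget v [set w | f w = n].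
have eK w : e (f w) = w.
  by rewrite /e; case: xgetP => [x _ /finj //|/(_ w) []].
have null : (haar mu).-negligible (\bigcup_k \bigcup_l
    (if (e k != v) && (0 < l)%N then branch_torsion v (e k) l else set0)).
  apply: negligible_bigcup => k; apply: negligible_bigcup => l.
  case: ifP => [/andP[kv l0]|_]; last exact: negligible_set0.
  apply/negligibleP; last exact: haar_branch_torsion.
  by apply: closed_measurable_aut; exact: branch_torsion_closed.
have tor0 : haar mu (stabilizer v `&` torsion) = 0%E.
  apply: measure_negligible; first by apply: measurableI => //; exact: torsion_measurable.
  apply: negligibleS null => g [gv [m _ gm]].
  have [w [l [wv l0 gwl]]] := torsion_branch d3 gv (ltn0Sn m) (fun x => gm x I).
  by exists (f w) => //; exists l => //; rewrite eK wv l0.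
have <- : haar mu (stabilizer v) = 1%E by exact: haar_stabilizer.
by rewrite (measureDI (haar mu) mS torsion_measurable) /= tor0 adde0.
Qed.

End torsion_measure.

(** * The measure of the set of translations *)

Section hyperbolic_measure.
Variables (R : realType) (T : regularTree) (mu : haarMeasure R T) (u z : T).
Hypotheses (d3 : (3 <= degree T)%N) (uz : adj u z).

Definition hyperbolic_at : set (aut T) :=
  [set b | desc u z (b u) /\ b z != par u (b u)].

Lemma hyperbolic_open : open hyperbolic_at.
Proof.
apply/aut_openP => g [gu gz]; exists [:: u; z] => h hg.
by rewrite /hyperbolic_at /= !hg ?inE ?eqxx ?orbT.
Qed.

(** Translates of [E] give the elements taking [u] to the [k]-th vertex of a ray below [z] without
    turning back. They are translations, and distinct [k] are told apart by the image of [u]. *)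
Lemma haar_hyperbolic : haar mu hyperbolic_at = +oo%E.
Proof.
pose E : set (aut T) := [set b | b u = u /\ b z != z].
have oE : open E.
  apply/aut_openP => g gE; exists [:: u; z] => h hg.
  by rewrite /E /= !hg ?inE ?eqxx ?orbT.
have mE := open_measurable_aut oE.
have [z2 [_ [uz2 _ z2z _ _]]] := three_nbrs u z d3.
have [h [hu hz]] := aut_transitive uz uz2.
(* The stabilizer of [u] is covered by [E] and one translate of it: if [b] fixes [z], then [h * b]
   moves [z] to [z2]. *)
have Epos : (0 < haar mu E)%E.
  rewrite lt_neqAle measure_ge0 andbT eq_sym; apply/negP => /eqP E0.
  have mE' : measurable [set b | E (h * b)%g] by exact: aut_measurable_mull.
  have : (haar mu (stabilizer u) <= haar mu E + haar mu E)%E.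
    rewrite -{2}(haar_mull mu h mE).
    apply: le_trans (measureU2 _ mE mE'); apply: le_measure; rewrite ?inE.
    - exact: measurable_stabilizer.
    - exact: measurableU.
    move=> b bu; have [bz|bz] := eqVneq (b z) z; [right|by left].
    by change ((h * b)%g u = u /\ (h * b)%g z != z); rewrite !autM bu bz hu hz.
  by rewrite E0 adde0 /haar haar_stabilizer lee_fin ler10.
have [y [y0 yS]] := ray u z d3.
have zu : z != u by apply: contraTneq uz => ->; rewrite adj_irrefl.
have yu k : y k != u by case: k => [|k]; [rewrite y0|have [] := yS k].
have yz k : iter k (par u) (y k) = z.
  by elim: k => // k IH; rewrite iterSr; have [_ ->] := yS k.
(* [g k] brings the edge from [y k] to its parent back to the edge [uz]. *)
have /choice[g gP] k : exists g : aut T, g (y k) = u /\ g (par u (y k)) = z.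
  by have [yp _] := parP (yu k); exact: aut_transitive yp uz.
apply: (haar_disjoint_translates (h := g) mE _ Epos).
- by apply: open_measurable_aut; exact: hyperbolic_open.
- move=> k b [bu bz]; have [gy gpy] := gP k.
  have byk : b u = y k by apply: (@aut_injective _ (g k)); rewrite -autM bu.
  rewrite /hyperbolic_at /= byk; split; first by exists k.
  by apply: contra_neq bz; rewrite autM => ->.
- move=> k l b [bk _] [bl _].
  have ykl : y k = y l.
    transitivity (b u); [symmetry|].
      by apply: (@aut_injective _ (g k)); rewrite -autM bk (gP k).1.
    by apply: (@aut_injective _ (g l)); rewrite -autM bl (gP l).1.
  have := desc_depth zu (yz k); have := desc_depth zu (yz l); rewrite ykl; lia.
Qed.

End hyperbolic_measure.

(** * Signs on spheres *)

Section sphere_sign.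
Variables (T : regularTree) (v : T).
Implicit Types (g h : aut T) (n : nat).

Definition sphere n : {fset T} := fset_set [set x | depth v x = n].

Lemma in_sphere n x : (x \in sphere n) = (depth v x == n).
Proof.
rewrite in_fset_set; last exact: finite_sphere.
by apply/idP/eqP => [/set_mem|xn]; last exact/mem_set.
Qed.

Lemma aut_sphere g n (x : sphere n) : g v = v -> g (val x) \in sphere n.
Proof. by move=> gv; have := valP x; rewrite !in_sphere -{2}gv aut_depth. Qed.

Definition sphere_fun g n (x : sphere n) : sphere n := insubd x (g (val x)).

Lemma val_sphere_fun g n (x : sphere n) : g v = v ->
  val (sphere_fun g x) = g (val x).
Proof. by move=> gv; rewrite val_insubd aut_sphere. Qed.

Lemma sphere_fun_inj g n : g v = v -> injective (@sphere_fun g n).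
Proof.
by move=> gv x y /(congr1 val); rewrite !val_sphere_fun// => /aut_injective/val_inj.
Qed.

(** The value 1 for automorphisms moving [v] is a default that makes the sign total. *)
Definition sphere_perm g n : {perm (sphere n)} :=
  if pselect (g v = v) is left gv then perm (sphere_fun_inj gv) else 1%g.

Lemma sphere_permE g n x : g v = v -> val (sphere_perm g n x) = g (val x).
Proof.
by rewrite /sphere_perm; case: pselect => // gv _; rewrite permE val_sphere_fun.
Qed.

(** The order is reversed because permutations compose from left to right. *)
Lemma sphere_permM g h n : g v = v -> h v = v ->
  sphere_perm (g * h)%g n = (sphere_perm h n * sphere_perm g n)%g.
Proof.
move=> gv hv; apply/permP => x; apply: val_inj.
by rewrite sphere_permE ?permM ?sphere_permE// autM hv gv.
Qed.

Lemma eq_sphere_perm g h n : g v = v -> h v = v ->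
  {in sphere n, g =1 h} -> sphere_perm g n = sphere_perm h n.
Proof.
move=> gv hv gh; apply/permP => x; apply: val_inj.
by rewrite !sphere_permE// gh// (valP x).
Qed.

Lemma sphere_perm1 g n : g v = v -> {in sphere n, forall x, g x = x} ->
  sphere_perm g n = 1%g.
Proof.
move=> gv gid; apply/permP => x; apply: val_inj.
by rewrite sphere_permE// perm1 gid// (valP x).
Qed.

Lemma sphere_perm_swap g n a b : g v = v -> a != b -> depth v a = n -> depth v b = n ->
  g a = b -> g b = a -> (forall x, depth v x = n -> x != a -> x != b -> g x = x) ->
  sphere_perm g n : bool.
Proof.
move=> gv ab da db ga gb gid.
have aS : a \in sphere n by rewrite in_sphere da.
have bS : b \in sphere n by rewrite in_sphere db.
suff -> : sphere_perm g n = tperm [` aS]%fset [` bS]%fset.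
  by rewrite odd_tperm -val_eqE.
apply/permP => x; apply: val_inj; rewrite sphere_permE//.
case: tpermP => [->|->|/eqP + /eqP] //; rewrite -!val_eqE => xa xb.
by apply: gid => //; apply/eqP; rewrite -in_sphere (valP x).
Qed.

(** Values in ['F_2] make the sign additive, so that linear algebra applies. *)
Definition sgn n g : 'F_2 := (sphere_perm g n : bool)%:R.

Lemma sgnM n g h : g v = v -> h v = v -> sgn n (g * h)%g = sgn n g + sgn n h.
Proof.
move=> gv hv; rewrite /sgn sphere_permM// odd_permM addbC.
by do 2 case: odd_perm; apply/val_inj.
Qed.

Lemma sgn1 n : sgn n 1%g = 0.
Proof. by rewrite /sgn sphere_perm1 ?odd_perm1. Qed.


Lemma sgn_swap n g a b : g v = v -> a != b -> depth v a = n -> depth v b = n ->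
  g a = b -> g b = a -> (forall x, depth v x = n -> x != a -> x != b -> g x = x) ->
  sgn n g = 1.
Proof. by move=> *; rewrite /sgn (@sphere_perm_swap _ _ a b). Qed.

Lemma sgn_id n g : g v = v -> (forall x, depth v x = n -> g x = x) -> sgn n g = 0.
Proof.
move=> gv gid; rewrite /sgn sphere_perm1 ?odd_perm1// => x.
by rewrite in_sphere => /eqP; exact: gid.
Qed.

Definition sgn_form k (L : 'I_k -> nat) (c : 'rV['F_2]_k) g : 'F_2 :=
  \sum_(j < k) c ord0 j * sgn (L j) g.

Lemma sgn_formM k L c g h : g v = v -> h v = v ->
  @sgn_form k L c (g * h)%g = sgn_form L c g + sgn_form L c h.
Proof.
move=> gv hv; rewrite /sgn_form -big_split; apply: eq_bigr => j _.
by rewrite sgnM// mulrDr.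
Qed.

Lemma sgn_form1 k L c : @sgn_form k L c 1%g = 0.
Proof. by rewrite /sgn_form big1// => j _; rewrite sgn1 mulr0. Qed.

(** A matrix with [n.+1] rows and [n] columns has a nonzero left kernel. *)
Lemma sgn_form_kernel n (L : 'I_n.+1 -> nat) (a : 'I_n -> aut T) :
  exists2 c, c != 0 & forall i, sgn_form L c (a i) = 0.
Proof.
pose A := \matrix_(j < n.+1, i < n) sgn (L j) (a i).
have kN0 : kermx A != 0.
  by rewrite -mxrank_eq0 mxrank_ker -lt0n subn_gt0 ltnS rank_leq_col.
exists (nz_row (kermx A)); first by rewrite nz_row_eq0.
move=> i; have /sub_kermxP/matrixP/(_ ord0 i) := nz_row_sub (kermx A).
by rewrite !mxE => <-; apply: eq_bigr => j _; rewrite mxE.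
Qed.

End sphere_sign.

(** * The closure of the generated subgroup *)

Section generated.
Variables (T U : regularTree) (n : nat) (a : n.-tuple (aut T * aut U)).

Local Notation Gamma := (generated_subgroup [set` a]).
Local Notation H := (closure Gamma).

Lemma generatedX x k : x \in a -> Gamma (x ^+ k)%g.
Proof.
move=> xa M [Mg aM]; have Mx : x \in M by apply/mem_set/aM.
apply/set_mem; elim: k => [|k IH]; first by case: Mg.
by rewrite expgS; exact: (group_closedM Mg).
Qed.

Lemma generated1 : Gamma 1%g.
Proof. by move=> M [[/set_mem]]. Qed.

Lemma pair_expg (x : aut T * aut U) k : (x ^+ k)%g = ((x.1 ^+ k)%g, (x.2 ^+ k)%g).
Proof. by elim: k => // k IH; rewrite !expgS IH. Qed.

Lemma pair_nbhsP (p : aut T * aut U) V :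
  nbhs p V <-> exists (s : seq T) (t : seq U), forall q : aut T * aut U,
    {in s, q.1 =1 p.1} -> {in t, q.2 =1 p.2} -> V q.
Proof.
split=> [[[A B] /= [/aut_nbhsP[s sA] /aut_nbhsP[t tB]] AB]|[s [t stV]]].
  by exists s, t => q /sA Aq /tB Bq; exact: AB.
exists ([set g : aut T | {in s, g =1 p.1}], [set g : aut U | {in t, g =1 p.2}]) => /=.
  by split; apply/aut_nbhsP; [exists s|exists t].
by move=> q [/= qs qt]; exact: stV.
Qed.

(** A cluster point of the powers of [x] would have two different powers agreeing with it, hence
    with each other, at [u]. *)
Lemma generated_not_compact (u : U) (x : aut T * aut U) :
  x \in a -> injective (fun k => iter k x.2 u) -> ~ compact H.
Proof.
move=> xa xinj cH; pose F := (fun k => (x ^+ k)%g) @ \oo.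
have FH : F H.
  by exists 0%N => // k _ /=; apply: subset_closure; exact: generatedX.
have [p [Hp clp]] := cH F _ FH.
have Bp : nbhs p [set q : aut T * aut U | q.2 u = p.2 u].
  by apply/pair_nbhsP; exists [::], [:: u] => q _ /=; apply; rewrite inE.
have FA k : F [set (x ^+ j)%g | j in [set j | (k <= j)%N]].
  by exists k => // j /= kj; exists j.
have [_ [[k _ <-] /= kp]] := clp _ _ (FA 0%N) Bp.
(* Starting from [k.+1] makes the second exponent different from the first. *)
have [_ [[j kj <-] /= jp]] := clp _ _ (FA k.+1) Bp.
move: jp; rewrite -kp !pair_expg /= !aut_expE => /xinj jk.
by move: kj; rewrite /= jk ltnn.
Qed.

Lemma finite_orbit_seq (S : regularTree) (v : S) (g : aut S) (s : seq S) : g v = v ->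
  exists2 k, (0 < k)%N & {in s, forall x, iter k g x = x}.
Proof.
move=> gv; elim: s => [|x s [k k0 ks]]; first by exists 1%N.
have [l l0 lx] := finite_orbit x gv.
exists (k * l)%N; first by rewrite muln_gt0 k0.
move=> y; rewrite inE => /predU1P[->|ys]; first by rewrite iterM iter_fix.
by rewrite mulnC iterM iter_fix// ks.
Qed.

(** Orbits of [x] are finite in both trees, so some positive power fixes any given finite sets. If 1
    were isolated, that power would be 1 and [x.1] torsion. *)
Lemma generated_not_discrete (v : T) (u : U) (x : aut T * aut U) :
  x \in a -> x.1 v = v -> x.2 u = u -> ~ torsion x.1 -> ~ discrete_subset H.
Proof.
move=> xa xv xu xtor dH.
have : isolated H 1%g by rewrite dH; apply: subset_closure; exact: generated1.
move=> [_ [V /pair_nbhsP[s [t stV]] VH]].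
have [k k0 ks] := finite_orbit_seq s xv; have [l l0 lt] := finite_orbit_seq t xu.
have : (V `&` H) (x ^+ (k * l))%g.
  split; last by apply: subset_closure; exact: generatedX.
  apply: stV => y yst; rewrite pair_expg /= aut_expE.
    by rewrite mulnC iterM iter_fix// ks.
  by rewrite iterM iter_fix// lt.
rewrite VH pair_expg => -[x1 _]; apply: xtor; exists (k * l).-1 => // y _ /=.
by rewrite -iterS prednK ?muln_gt0 ?k0// -aut_expE x1.
Qed.

(** If a neighbourhood of 1 lay in the closure, it would contain a swap on which some combination of
    signs is nonzero, although that combination vanishes on the generators, hence on the closure. *)
Lemma generated_not_open (v : T) : (3 <= degree T)%N ->
  (forall x, x \in a -> x.1 v = v) -> ~ open H.
Proof.
rewrite openE => d3 av HO.
have /pair_nbhsP[s [t stH]] : nbhs (1%g : aut T * aut U) H.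
  by apply: HO; apply: subset_closure; exact: generated1.
have [w [_ [vw _ wv _ _]]] := three_nbrs v v d3.
have [h [_ hswap]] := branch_swaps d3 wv.
(* All levels [L j] lie deeper than [s], so that the swap chosen below fixes [s]. *)
pose m := \max_(x <- s) depth v x.
pose L (j : 'I_n.+1) := (depth v w + (m + j)).+1.
have [c cN0 ca] := sgn_form_kernel v L (fun i => (tnth a i).1).
have Gc p : Gamma p -> p.1 v = v /\ sgn_form v L c p.1 = 0.
  pose K := [set p : aut T * aut U | p.1 v = v /\ sgn_form v L c p.1 = 0].
  suff : Gamma `<=` K by apply.
  apply: smallest_sub => [|x xa]; last first.
    split; first exact: av.
    by have /tnthP[i ->] : x \in a by []; exact: ca.
  split; first by apply/mem_set; split=> //; exact: sgn_form1.
  move=> x y /set_mem[xv xc] /set_mem[yv yc]; apply/mem_set.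
  have yVv : (y.1^-1)%g v = v by rewrite -{1}yv autK.
  have yVc : sgn_form v L c (y.1^-1)%g = 0.
    by have := sgn_form1 v L c; rewrite -(mulgV y.1) sgn_formM// yc add0r.
  split; first by change (x.1 ((y.1^-1)%g v) = v); rewrite yVv.
  by rewrite /= sgn_formM// xc yVc addr0.
have [j0 cj0] : exists j, c ord0 j != 0.
  by apply/rV0Pn.
(* Take the last nonzero coefficient: the swap at level [L j] is trivial on the earlier spheres, and
   the later ones have coefficient 0, so the form takes the value [c ord0 j]. *)
case: (@arg_maxnP _ j0 (fun j => c ord0 j != 0) (fun j => j : nat)) => // j cj jmax.
have [x [y [xy wx dx dy [hx hy hid]]]] := hswap (m + j)%N.
set g := h (m + j)%N in hx hy hid.
have small z : (depth v z <= depth v w + (m + j))%N -> g z = z.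
  move=> zle; apply: hid; first exact: leqW.
    by apply: contraTneq zle => ->; rewrite dx ltnn.
  by apply: contraTneq zle => ->; rewrite dy ltnn.
have gv : g v = v by apply: small; rewrite depth_root.
have gc : sgn_form v L c g = c ord0 j.
  rewrite /sgn_form (bigD1 j)//= (@sgn_swap _ _ _ _ x y) ?mulr1//; last first.
    by move=> z dz; apply: hid; rewrite dz.
  rewrite big1 ?addr0// => i ij.
  have [ci|ci] := eqVneq (c ord0 i) 0; first by rewrite ci mul0r.
  have : (i <= j)%N := jmax i ci; rewrite leq_eqVlt => /predU1P[/val_inj ji|ilt].
    by rewrite ji eqxx in ij.
  rewrite sgn_id ?mulr0// => z dz; apply: small; rewrite dz /L; lia.
have Hg : H (g, 1%g).
  apply: stH => z zs //=; apply: small.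
  have : (depth v z <= m)%N by apply: leq_bigmax_seq.
  lia.
(* The form depends only on these finitely many vertices, so an element of the group close to [g]
   has the same value. *)
pose r := [seq z | i <- enum 'I_n.+1, z <- sphere v (L i)].
have Vg : nbhs (g, 1%g : aut U) [set p : aut T * aut U | {in r, p.1 =1 g}].
  by apply/pair_nbhsP; exists r, [::].
have [p [/Gc[pv pc] pg]] := Hg _ Vg.
suff : sgn_form v L c p.1 = sgn_form v L c g by rewrite pc gc => /esym/eqP; rewrite (negPf cj).
apply: eq_bigr => i _; congr (_ * _); rewrite /sgn (@eq_sphere_perm _ _ _ g)// => z zi.
by apply: pg; apply/allpairsPdep; exists i, z; rewrite mem_enum.
Qed.

End generated.

(** * The set of tuples and its measure *)

Lemma measurable_tuple_box d (A : measurableType d) n (B : 'I_n -> set A) :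
  (forall i, measurable (B i)) ->
  measurable [set t : n.-tuple A | forall i, B i (tnth t i)].
Proof.
move=> mB; rewrite (_ : mkset _ = \bigcap_(i in [set: 'I_n])
    ((fun t : n.-tuple A => tnth t i) @^-1` B i)).
  apply: fin_bigcap_measurable => // i _.
  by rewrite -[X in measurable X]setTI; exact: measurable_tnth.
by apply/seteqP; split=> t /= Bt i; [move=> _; exact: Bt|exact: Bt].
Qed.

Lemma product_haarX (R : realType) (T U : regularTree) (mu : haarMeasure R T)
    (nu : haarMeasure R U) (A : set (aut T)) (B : set (aut U)) :
  measurable A -> measurable B ->
  product_haar mu nu (A `*` B) = (haar mu A * haar nu B)%E.
Proof. exact: product_measure1E. Qed.

Theorem proposition17 (R : realType) (T U : regularTree)
    (hT : (3 <= degree T)%N) (hU : (3 <= degree U)%N)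
    (mu : haarMeasure R T) (nu : haarMeasure R U) (n : nat) (hn : (2 <= n)%N) :
  exists X : set (n.-tuple (aut T * aut U)),
    [/\ measurable X,
        power_measure (product_haar mu nu) n X = +oo%E &
        forall a : n.-tuple (aut T * aut U), X a ->
          let H := closure (generated_subgroup [set` a]) in
          [/\ ~ discrete_subset H, ~ open H & ~ compact H]].
Proof.
case: n hn => [|[|n]] // _.
have [v] := tree_nonempty T; have [u] := tree_nonempty U.
have [z [_ [uz _ _ _ _]]] := three_nbrs u u hU.
(* A product of boxes: the second factor has infinite measure and every other one measure exactly 1,
   so the product is infinite. *)
pose B (i : 'I_n.+2) : set (aut T * aut U) :=
  if i == ord0 then (stabilizer v `\` @torsion T) `*` stabilizer u
  else if i == lift ord0 ord0 then stabilizer v `*` hyperbolic_at u z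
  else stabilizer v `*` stabilizer u.
have mtor : measurable (stabilizer v `\` @torsion T).
  by apply: measurableD; [exact: measurable_stabilizer|exact: torsion_measurable].
have mhyp : measurable (hyperbolic_at u z).
  by apply: open_measurable_aut; exact: hyperbolic_open.
have mv := measurable_stabilizer v; have mu' := measurable_stabilizer u.
have mB i : measurable (B i).
  by rewrite /B; case: ifP => _; [|case: ifP => _]; apply: measurableX.
exists [set t | forall i, B i (tnth t i)]; split.
- exact: measurable_tuple_box.
- rewrite power_measureE// !big_ord_recl /= big1 => [|i _].
    rewrite /B /= !product_haarX// haar_nontorsion// haar_hyperbolic//.
    by rewrite /haar !haar_stabilizer !mul1e mule1.
  rewrite /B /= product_haarX//.
  by rewrite /haar !haar_stabilizer mule1.
move=> a aB /=.
have a0 : B ord0 (tnth a ord0) by exact: aB.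
have a1 : B (lift ord0 ord0) (tnth a (lift ord0 ord0)) by exact: aB.
have av x : x \in a -> x.1 v = v.
  move=> /tnthP[i ->]; have := aB i; rewrite /B.
  by case: ifP => _; [move=> [[]]|case: ifP => _ []].
split.
- move: a0; rewrite /B eqxx => -[[a0v a0tor] a0u].
  exact: generated_not_discrete (mem_tnth _ _) a0v a0u a0tor.
- exact: generated_not_open hT av.
- move: a1; rewrite /B /= => -[_ [a1u a1z]].
  exact: generated_not_compact (mem_tnth _ _) (hyperbolic_orbit uz a1u a1z).
Qed.
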